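(* Let $N$ be a Poisson process with rate $1$ and let $Z_1,Z_2,\dots$ be i.i.d. non-negative random variables, independent of $N$, with $\mathbf EZ_1=1$ and $\mathbf P(Z_1\ge x)\sim\exp(-x^{\alpha})$ as $x\to\infty$, where $\alpha=1/2$. Let $\bar X_n(t)=\frac1n\sum_{i=1}^{N(nt)}Z_i-t$, $t\in[0,1]$, and $$I(\xi)=\begin{cases}\sum_{t\in[0,1]}\big(\xi(t)-\xi(t-)\big)^{\alpha}&\text{if }\xi\in\mathbb D_{\leqslant\infty},\\ \infty&\text{otherwise.}\end{cases}$$ Then there exists a set $A\subseteq\mathbb D[0,1]$, closed in the $J_1$ topology, such that $$\limsup_{n\to\infty}\frac{\log\mathbf P(\bar X_n\in A)}{n^{\alpha}}>-\inf_{\xi\in A}I(\xi).$$ Consequently, $\bar X_n$ does not satisfy a (full) large deviation principle in $\mathbb D[0,1]$ with the $J_1$ topology and speed $n^{\alpha}$.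
   Context: $\mathbb D[0,1]$ is the space of càdlàg functions $[0,1]\to\mathbb R$; the $J_1$ topology is induced by $d_{J_1}(\xi,\zeta)=\inf_{\lambda}\max\{\|\xi-\zeta\circ\lambda\|_\infty,\|\lambda-e\|_\infty\}$, $\lambda$ ranging over non-decreasing homeomorphisms of $[0,1]$ onto itself, $e(t)=t$. $\mathbb D_{\leqslant\infty}$ is the set of functions $\xi=\sum_{i=1}^\infty x_i\mathbf 1_{[u_i,1]}$ with $x_i\ge0$ and distinct $u_i\in(0,1)$ (so $\xi(0)=0$ and $t=0$ contributes nothing to the sum). A full LDP with speed $a_n$ and rate function $J$ ($[0,\infty]$-valued, lower semi-continuous) means: for every measurable $B$, $-\inf_{B^\circ}J\le\liminf_n a_n^{-1}\log\mathbf P(\bar X_n\in B)\le\limsup_n a_n^{-1}\log\mathbf P(\bar X_n\in B)\le-\inf_{B^-}J$, with $B^\circ,B^-$ the interior and closure. *)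

(* Defs.v *)
From HB Require Import structures.
From mathcomp Require Import all_boot all_order all_algebra.
From mathcomp Require Import all_classical all_reals all_analysis.

Set Implicit Arguments.
Unset Strict Implicit.
Unset Printing Implicit Defensive.

Import Order.TTheory GRing.Theory Num.Theory.
Import numFieldNormedType.Exports.

Local Open Scope classical_set_scope.
Local Open Scope ring_scope.

Notation I01 R := (set_type (`[0, 1]%classic : set R)).

Definition at_left01 (R : realType) (t : I01 R) : set_system (I01 R) :=
  within [set s | \val s < \val t] (nbhs t).
Definition at_right01 (R : realType) (t : I01 R) : set_system (I01 R) :=
  within [set s | \val t < \val s] (nbhs t).

(* At t = 0 (resp. t = 1) the filter at_left01 t (resp. at_right01 t) contains
   every set, so that the corresponding condition is vacuous. *)
Definition cadlag (R : realType) (f : I01 R -> R) : Prop :=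
  forall t, f s @[s --> at_right01 t] --> f t /\
    exists l : R, f s @[s --> at_left01 t] --> l.

Record skorokhod (R : realType) := Skorokhod {
  sk_path :> I01 R -> R;
  sk_path_cadlag : cadlag sk_path }.

HB.instance Definition _ (R : realType) := gen_eqMixin (skorokhod R).
HB.instance Definition _ (R : realType) := gen_choiceMixin (skorokhod R).

Definition time_change (R : realType) : set (I01 R -> I01 R) :=
  [set lam : I01 R -> I01 R | {homo lam : s t / \val s <= \val t} /\ continuous lam /\
    exists mu : I01 R -> I01 R,
      [/\ cancel lam mu, cancel mu lam & continuous mu]].

(* Suprema and infima are taken in \bar R: over R, sup and inf of unbounded or
   empty sets are 0 by convention. *)
Definition supdist01 (R : realType) (f g : I01 R -> R) : \bar R :=
  ereal_sup [set (`|f t - g t|)%:E | t in [set: I01 R]].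

Definition J1dist (R : realType) (xi zeta : skorokhod R) : \bar R :=
  ereal_inf [set maxe (supdist01 xi (zeta \o lam))
                      (supdist01 (fun t => \val (lam t)) (fun t => \val t))
            | lam in @time_change R].

Section J1_pseudometric.
Context {R : realType}.
Implicit Types (x y z : skorokhod R) (lam mu : I01 R -> I01 R).

Definition J1ball x (e : R) y : Prop := (J1dist x y < e%:E)%E.

Lemma supdist01_le (f g : I01 R -> R) (e : \bar R) :
  (supdist01 f g <= e)%E <-> forall t, ((`|f t - g t|)%:E <= e)%E.
Proof.
split=> [h t|h]; last by apply: ge_ereal_sup => _ [t _ <-].
by apply: le_trans h; apply: ereal_sup_ubound; exists t.
Qed.

Lemma J1ballP x (e : R) y : J1ball x e y <->
  exists2 lam, time_change lam & exists2 r : R, r < e &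
    (forall t, `|x t - y (lam t)| <= r) /\
    (forall t, `|\val (lam t) - \val t| <= r).
Proof.
split.
  move=> /ereal_inf_lt[_ [lam tl <-]]; rewrite gt_max => /andP[].
  set a := supdist01 _ _; set b := supdist01 _ _ => ae be.
  exists lam => //.
  have i0 : I01 R.
    by exists 0; apply/mem_set; rewrite /= in_itv/= lexx ler01.
  have a0 : (0 <= a)%E.
    apply: (@le_trans _ _ (`|x i0 - (y \o lam) i0|)%:E).
      by rewrite lee_fin.
    by apply: ereal_sup_ubound; exists i0.
  have b0 : (0 <= b)%E.
    apply: (@le_trans _ _ (`|\val (lam i0) - \val i0|)%:E).
      by rewrite lee_fin.
    by apply: ereal_sup_ubound; exists i0.
  have m0 : (0 <= maxe a b)%E by rewrite le_max a0.
  have me : (maxe a b < e%:E)%E by rewrite gt_max ae be.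
  have mf : maxe a b \is a fin_num.
    by rewrite ge0_fin_numE// (lt_trans me)// ltry.
  exists (fine (maxe a b)); first by rewrite -lte_fin fineK.
  split=> t; rewrite -lee_fin fineK//.
    by move: t; apply/(@supdist01_le x (y \o lam)); rewrite le_max lexx.
  move: t; apply/(@supdist01_le (fun t => \val (lam t)) (fun t => \val t)).
  by rewrite le_max lexx orbT.
move=> [lam tl [r re [h1 h2]]].
apply: (@le_lt_trans _ _ r%:E); last by rewrite lte_fin.
apply: (@le_trans _ _ (maxe (supdist01 x (y \o lam))
  (supdist01 (fun t => \val (lam t)) (fun t => \val t)))).
  by apply: ereal_inf_lbound; exists lam.
by rewrite ge_max; apply/andP; split; apply/supdist01_le => t; rewrite lee_fin.
Qed.

Lemma time_change_id : time_change (@id (I01 R)).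
Proof. by split=> //; split; [move=> t|exists id; split => // t]. Qed.

Lemma time_change_inv lam mu : time_change lam ->
  cancel lam mu -> cancel mu lam -> continuous mu -> time_change mu.
Proof.
move=> [h1 [h2 _]] lm ml cm; split; last by split=> //; exists lam; split.
move=> s t st; rewrite leNgt; apply/negP => ts.
have := h1 _ _ (ltW ts); rewrite !ml => ts'.
have ste : s = t by apply/val_inj/eqP; rewrite eq_le st.
by move: ts; rewrite ste ltxx.
Qed.

Lemma time_change_comp lam mu :
  time_change lam -> time_change mu -> time_change (mu \o lam).
Proof.
move=> [l1 [l2 [l3 [l4 l5 l6]]]] [m1 [m2 [m3 [m4 m5 m6]]]]; split.
  by move=> s t /l1 /m1.
split; first by move=> t; apply: continuous_comp; [exact: l2|exact: m2].
exists (l3 \o m3); split; first exact: can_comp.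
  exact: can_comp.
by move=> t; apply: continuous_comp; [exact: m6|exact: l6].
Qed.

Lemma J1ball_center x (e : R) : 0 < e -> J1ball x e x.
Proof.
move=> e0; apply/J1ballP; exists id; first exact: time_change_id.
by exists 0 => //; split=> t; rewrite subrr normr0.
Qed.

Lemma J1ball_sym x y (e : R) : J1ball x e y -> J1ball y e x.
Proof.
move=> /J1ballP[lam tl [r re [h1 h2]]]; apply/J1ballP.
have [_ [_ [mu [lm ml cm]]]] := tl.
exists mu; first exact: (time_change_inv tl).
exists r => //; split=> t.
  by have := h1 (mu t); rewrite ml distrC.
by have := h2 (mu t); rewrite ml distrC.
Qed.

Lemma J1ball_triangle x y z (e1 e2 : R) :
  J1ball x e1 y -> J1ball y e2 z -> J1ball x (e1 + e2) z.
Proof.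
move=> /J1ballP[lam tl [r re [h1 h2]]] /J1ballP[mu tm [q qe [k1 k2]]].
apply/J1ballP; exists (mu \o lam); first exact: time_change_comp.
exists (r + q); first exact: ltrD.
split=> t /=.
  by rewrite -(subrKA (y (lam t))) (le_trans (ler_normD _ _))// lerD.
rewrite -(subrKA (\val (lam t))) (le_trans (ler_normD _ _))//.
by rewrite [leRHS]addrC; apply: lerD; [exact: k2|exact: h2].
Qed.

Definition J1nbhs (x : skorokhod R) : set_system (skorokhod R) :=
  nbhs_ (entourage_ J1ball) x.

HB.instance Definition _ := hasNbhs.Build (skorokhod R) J1nbhs.

Let J1nbhsE : nbhs = nbhs_ (entourage_ J1ball). Proof. by []. Qed.

HB.instance Definition _ := @Nbhs_isPseudoMetric.Build R (skorokhod R)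
  (entourage_ J1ball) J1nbhsE J1ball J1ball_center J1ball_sym J1ball_triangle
  erefl.

End J1_pseudometric.

Definition mutually_independent d (T : measurableType d) (R : realType)
    (P : probability T R) (I : eqType) d' (S : measurableType d')
    (X : I -> T -> S) : Prop :=
  forall (s : seq I) (B : I -> set S), uniq s ->
    (forall i, measurable (B i)) ->
    P (\bigcap_(i in [set` s]) (X i @^-1` B i)) =
    (\prod_(i <- s) P (X i @^-1` B i))%E.

(* The sigma-algebra generated by the random variables X i, i in D. *)
Definition sigma_gen (T I : Type) d' (S : measurableType d')
    (D : set I) (X : I -> T -> S) : set (set T) :=
  <<s [set A | exists2 i, D i & exists2 B : set S,
         measurable B & A = X i @^-1` B] >>.

Definition independent_classes d (T : measurableType d) (R : realType)
    (P : probability T R) (G H : set (set T)) : Prop :=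
  forall A B, G A -> H B -> P (A `&` B) = (P A * P B)%E.

(* Only times t >= 0 are relevant. *)
Record counting_process (R : realType) (T : Type) := CountingProcess {
  cp_count :> R -> T -> nat;
  count_at0 : forall w, cp_count 0 w = 0%N;
  count_nondecreasing : forall w s t,
    0 <= s -> s <= t -> (cp_count s w <= cp_count t w)%N;
  count_right_continuous : forall w t, 0 <= t ->
    \forall s \near t^'+, cp_count s w = cp_count t w }.

Record is_Poisson_process d (T : measurableType d) (R : realType)
    (P : probability T R) (rate : R) (N : counting_process R T) : Prop := {
  Poisson_measurable : forall t, 0 <= t -> measurable_fun setT (N t);
  Poisson_independent_increments : forall t : nat -> R,
    0 <= t 0%N -> {homo t : i j / (i <= j)%N >-> i <= j} ->
    mutually_independent P (fun (i : nat) w => (N (t i.+1) w - N (t i) w)%N);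
  Poisson_increments : forall s t k, 0 <= s -> s < t ->
    P [set w | (N t w - N s w)%N = k] =
    (poisson_pmf (rate * (t - s)) k)%:E }.

Section Xbar.
Context d (T : measurableType d) (R : realType) (P : probability T R).
Context (N : counting_process R T) (Z : nat -> {RV P >-> R}).

(* Indices are shifted: Z i stands for Z_(i+1). *)
Definition Xbar_fun (n : nat) (w : T) (t : I01 R) : R :=
  n%:R^-1 * (\sum_(i < N (n%:R * \val t) w) Z i w) - \val t.

Lemma Xbar_fun_cvg (F : set_system (I01 R)) n w (t : I01 R) (m : nat) :
  Filter F -> F `=>` nbhs t -> (\forall s \near F, N (n%:R * \val s) w = m) ->
  Xbar_fun n w s @[s --> F] --> n%:R^-1 * (\sum_(i < m) Z i w) - \val t.
Proof.
move=> FF Ft Fm.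
apply: (@cvg_trans _
  ((fun s : I01 R => n%:R^-1 * (\sum_(i < m) Z i w) - \val s) @ F)).
  by apply: near_eq_cvg; apply: filterS Fm => s; rewrite /Xbar_fun => ->.
apply: cvgB; first exact: cvg_cst.
have := @initial_continuous _ _ (@set_val R `[0, 1]%classic) t.
by move=> h A /h; exact: Ft.
Qed.

Lemma Xbar_cadlag n w : cadlag (Xbar_fun n w).
Proof.
have cn (t : I01 R) : {for t, continuous (fun s : I01 R => n%:R * \val s)}.
  apply: (@continuous_comp _ _ _ (@set_val R `[0, 1]%classic) ( *%R n%:R)).
    exact: initial_continuous.
  exact: mulrl_continuous.
have ge0 (t : I01 R) : 0 <= \val t.
  by have := set_mem (valP t); rewrite /= in_itv/= => /andP[].
have nge0 (t : I01 R) : 0 <= n%:R * \val t by rewrite mulr_ge0.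
move=> t; split.
  apply: Xbar_fun_cvg; first exact: cvg_within.
  have [n0|n0] := posnP n.
    by apply: nearW => s; rewrite n0 !mul0r.
  suff : \forall s \near t, \val t < \val s ->
    N (n%:R * \val s) w = N (n%:R * \val t) w by [].
  have h := cn t _ (count_right_continuous N w (nge0 t)).
  apply: (@filterS _ (nbhs t) _ _ _ _ h) => s /= {}h ts; apply: h.
  by rewrite ltr_pM2l// ltr0n.
have [[s0 s0t]|tmin] := pselect (exists s : I01 R, \val s < \val t); last first.
  exists 0 => A _; apply: nearW => s st.
  by exfalso; apply: tmin; exists s.
pose Q k := `[< exists2 s : I01 R, \val s < \val t & N (n%:R * \val s) w = k >].
have exQ : exists k, Q k.
  by exists (N (n%:R * \val s0) w); apply/asboolP; exists s0.
have ubQ k : Q k -> (k <= N (n%:R * \val t)%R w)%N.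
  move=> /asboolP[s st <-]; apply: count_nondecreasing => //.
  by rewrite ler_wpM2l// ltW.
have [m /asboolP[s1 s1t s1m] mmax] := ex_maxnP exQ ubQ.
exists (n%:R^-1 * (\sum_(i < m) Z i w) - \val t).
apply: Xbar_fun_cvg; first exact: cvg_within.
suff : \forall s \near t, \val s < \val t -> N (n%:R * \val s) w = m by [].
have h := @initial_continuous _ _ (@set_val R `[0, 1]%classic) t _
  (lt_nbhsr s1t : nbhs (\val t) [set y | \val s1 < y]).
apply: (@filterS _ (nbhs t) _ _ _ _ h) => s /= s1s st; apply/eqP; rewrite eqn_leq; apply/andP;
  split.
  by apply: mmax; apply/asboolP; exists s.
rewrite -s1m; apply: count_nondecreasing => //.
by rewrite ler_wpM2l// ltW.
Qed.

Definition Xbar (n : nat) (w : T) : skorokhod R := Skorokhod (Xbar_cadlag n w).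

End Xbar.

Definition step_series (R : realType) : set (I01 R -> R) :=
  [set xi | exists x u : nat -> R,
    [/\ forall i, 0 <= x i, forall i, 0 < u i < 1, injective u &
      forall t, (xi t)%:E =
        (\sum_(0 <= i <oo) (x i * \1_(`[u i, 1]%classic) (\val t))%:E)%E]].

(* xi(0-) := xi(0); the limit is only meaningful for t > 0. *)
Definition left_limit (R : realType) (xi : I01 R -> R) (t : I01 R) : R :=
  if \val t == 0 then xi t else lim (xi s @[s --> at_left01 t]).

Definition rate_function (R : realType) (alpha : R) (xi : skorokhod R) : \bar R :=
  if `[< step_series xi >] then
    \esum_(t in [set: I01 R]) ((xi t - left_limit xi t) `^ alpha)%:E
  else +oo%E.

(* P (X n @^-1` B) is meaningful only if X n is measurable for the Borel
   sigma-algebra of S. *)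
Record full_LDP d (T : measurableType d) (R : realType) (P : probability T R)
    (S : topologicalType) (X : nat -> T -> S) (a : nat -> R)
    (J : S -> \bar R) : Prop := {
  LDP_rate_ge0 : forall x, (0 <= J x)%E;
  LDP_rate_lsc : lower_semicontinuous J;
  LDP_bounds : forall B : set S, (<<s [set U : set S | open U] >>) B ->
    let u n := ((a n)^-1%:E * lne (P (X n @^-1` B)))%E in
    [/\ (- ereal_inf (J @` B°) <= limn_einf u)%E,
        (limn_einf u <= limn_esup u)%E &
        (limn_esup u <= - ereal_inf (J @` closure B))%E] }.

(* Main.v *)
Require Import Defs.
From mathcomp Require Import all_boot all_order all_algebra.
From mathcomp Require Import all_classical all_reals all_analysis.
From mathcomp Require Import lra.

Set Implicit Arguments.
Unset Strict Implicit.
Unset Printing Implicit Defensive.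

Import Order.TTheory GRing.Theory Num.Theory.
Import numFieldNormedType.Exports.

Local Open Scope classical_set_scope.
Local Open Scope ring_scope.

(** The set A of paths with xi(0) <= 0 such that, at every time t, either
    xi(t) + t <= 0 or xi(t) + t >= 1 is closed.  Right-continuity at 0 forces
    xi(t) <= -t on a right neighbourhood of 0, so no nondecreasing step function
    lies in A and I = +oo on A.  Yet Xbar_n is in A as soon as Z_1 >= n: the path
    runs along -t up to the first claim and stays above 1 - t afterwards.  Hence
    P(Xbar_n in A) is at least exp(-1 - n^alpha) eventually.  This does not clash
    with closedness because the first claim occurs at a time of order 1/n, and
    paths jumping at times that tend to 0 have no J1-limit.

    A full LDP with rate J would give J(xi) < +oo at some xi in A.  But xi has an
    open neighbourhood of paths with zeta(s) + s < eta for some s > a > 0, and for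
    small eta the compound Poisson process stays below eta n up to time n a only
    with probability exp(-c n), which is negligible at speed n^alpha. *)

(** * The closed set, its rate, and open neighbourhoods of its members *)

Section paths.
Context {R : realType}.
Implicit Types (xi zeta : skorokhod R) (t s : I01 R).

Lemma I01_bounds t : 0 <= \val t <= 1.
Proof. by have := set_mem (valP t); rewrite /= in_itv. Qed.

Lemma I01_ex (x : R) : 0 <= x <= 1 -> exists t, \val t = x.
Proof.
move=> x01; have h : x \in (`[0, 1]%classic : set R).
  by apply/mem_set; rewrite /= in_itv.
by exists (SigSub h).
Qed.

Lemma nbhs_I01 t (Q : set (I01 R)) : nbhs t Q ->
  exists2 e : R, 0 < e & forall s, `|\val s - \val t| < e -> Q s.
Proof.
rewrite nbhsE => -[_ [[V oV <-] Vt] VQ].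
have /nbhs_ballP[e /= e0 he] : nbhs (\val t) V by apply: open_nbhs_nbhs; split.
exists e => // s st; apply: VQ; apply: he.
by rewrite /ball /= distrC.
Qed.

Lemma time_change0 (lam : I01 R -> I01 R) t :
  time_change lam -> \val t = 0 -> \val (lam t) = 0.
Proof.
move=> [lam_homo [_ [mu [_ mulam _]]]] t0.
have h : \val t <= \val (mu t) by rewrite t0; case/andP: (I01_bounds (mu t)).
have := lam_homo _ _ h; rewrite mulam t0 => h'.
by apply/eqP; rewrite eq_le h'; case/andP: (I01_bounds (lam t)).
Qed.

Definition late_or_large : set (skorokhod R) :=
  [set xi | (forall t, \val t = 0 -> xi t <= 0) /\
    forall t, xi t + \val t <= 0 \/ 1 <= xi t + \val t].

(** Time changes fix 0, so the condition at 0 passes to the limit. A value of [xi t + \val t]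
    strictly inside (0,1) would put [zeta (lam t) + \val (lam t)] there too for any J1-close
    [zeta]. *)
Lemma closed_late_or_large : closed late_or_large.
Proof.
move=> xi clxi.
have near_xi (e : R) : 0 < e -> exists2 zeta, late_or_large zeta &
    exists2 lam, time_change lam &
    (forall t, `|xi t - zeta (lam t)| < e) /\
    (forall t, `|\val (lam t) - \val t| < e).
  move=> e0; have [zeta [zetaA xizeta]] := clxi _ (nbhsx_ballx xi e e0).
  exists zeta => //; have /J1ballP[lam tl [r re [h1 h2]]] := xizeta.
  exists lam => //; split=> t; apply: le_lt_trans re; [exact: h1|exact: h2].
split=> t.
  move=> t0; rewrite leNgt; apply/negP => xit.
  have [zeta [z0 _] [lam tl [/(_ t) h1 _]]] := near_xi _ xit.
  have := z0 _ (time_change0 tl t0); move: h1; rewrite ltr_norml; lra.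
have [|xit] := leP (xi t + \val t) 0; first by left.
have [|xit1] := leP 1 (xi t + \val t); first by right.
(* The distance from [xi t + \val t] to the complement of (0,1). It is halved since the value and
   the time each contribute an error. *)
pose e := Num.min (xi t + \val t) (1 - (xi t + \val t)).
have e0 : 0 < e / 2 by rewrite divr_gt0// lt_min xit subr_gt0.
have e1 : e <= xi t + \val t by rewrite ge_min lexx.
have e2 : e <= 1 - (xi t + \val t) by rewrite ge_min lexx orbT.
have [zeta [_ z01] [lam tl [/(_ t) h1 /(_ t) h2]]] := near_xi _ e0.
by case: (z01 (lam t)); move: h1 h2; rewrite !ltr_norml; lra.
Qed.

Lemma late_or_large_start xi : late_or_large xi ->
  exists2 s, 0 < \val s < 1 & xi s + \val s <= 0.
Proof.
move=> [xi0 xi01].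
have [z z0] : exists t, \val t = (0 : R) by apply: I01_ex; rewrite lexx ler01.
have h2 : (0 : R) < 1 / 2 by lra.
have := (sk_path_cadlag xi z).1 _ (nbhsx_ballx (xi z) _ h2) => /nbhs_I01[e e0 he].
(* At a time at most 1/3 within [e] of 0, the path is below 1/2, so [xi s + \val s] is below 5/6 and
   the alternative of being at least 1 is excluded. *)
pose m := Num.min (e / 2) (1 / 3).
have m0 : 0 < m by rewrite lt_min; apply/andP; split; lra.
have me : m <= e / 2 by rewrite ge_min lexx.
have m3 : m <= 1 / 3 by rewrite ge_min lexx orbT.
have [s sm] : exists t, \val t = m by apply: I01_ex; apply/andP; split; lra.
exists s; first by rewrite sm; apply/andP; split; lra.
case: (xi01 s) => // xis.
have /ltr_normlP[h3 h4] : `|xi z - xi s| < 1 / 2.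
  by apply: he; rewrite /= z0 sm ?subr0 ?gtr0_norm//; lra.
by have := xi0 _ z0; rewrite sm in xis; lra.
Qed.

Lemma step_series_ge0 (f : I01 R -> R) t : step_series f -> 0 <= f t.
Proof.
move=> [x [u [x0 _ _ fE]]]; rewrite -lee_fin fE.
by apply: nneseries_ge0 => i _ _; rewrite lee_fin mulr_ge0.
Qed.

Lemma rate_late_or_large (alpha : R) :
  ereal_inf (rate_function alpha @` late_or_large) = +oo%E.
Proof.
apply/eqP; rewrite -leye_eq; apply: le_ereal_inf_tmp => _ [xi xiA <-].
rewrite /rate_function; case: asboolP => // /step_series_ge0 xi_ge0.
have [s s01 xis] := late_or_large_start xiA.
by exfalso; have := xi_ge0 s; lra.
Qed.

(** The neighbourhood to which the LDP lower bound is applied. The strict inequalities make it open,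
    and [zeta s + \val s] is the scaled claim total when [zeta] is [Xbar]. *)
Definition low_after (a eta : R) : set (skorokhod R) :=
  [set zeta | exists2 s, a < \val s & zeta s + \val s < eta].

Lemma open_low_after a eta : open (low_after a eta).
Proof.
rewrite openE => zeta [s sa zs].
pose e := Num.min (\val s - a) ((eta - (zeta s + \val s)) / 2).
have e0 : 0 < e by rewrite lt_min; apply/andP; split; lra.
have e1 : e <= \val s - a by rewrite ge_min lexx.
have e2 : e <= (eta - (zeta s + \val s)) / 2 by rewrite ge_min lexx orbT.
apply/nbhs_ballP; exists e => //= zeta' /J1ballP[lam tl [r re [h1 h2]]].
exists (lam s); move: (h1 s) (h2 s); rewrite !ler_norml; lra.
Qed.

End paths.

(** * Elementary inequalities and measurability *)

Lemma two_le_expR1 (R : realType) : 2 <= expR 1 :> R.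
Proof. by have := expR_ge1Dx (1 : R); rewrite -[1 + 1]/2%:R. Qed.

Lemma exprn_fact_le_expR (R : realType) (x : R) k :
  0 <= x -> x ^+ k / k`!%:R <= expR x.
Proof.
move=> x0; case: k => [|k].
  by rewrite expr0 fact0 divr1 (le_trans _ (expR_ge1Dx _))// lerDl.
by apply: le_trans (expR_ge1Dxn k x0); rewrite lerDr.
Qed.

Lemma measure_bigsetU_le d (T : measurableType d) (R : realType)
    (mu : {measure set T -> \bar R}) (I : Type) (s : seq I) (F : I -> set T) :
  (forall i, measurable (F i)) ->
  (mu (\big[setU/set0]_(i <- s) F i) <= \sum_(i <- s) mu (F i))%E.
Proof.
move=> mF; elim: s => [|i s ih]; first by rewrite !big_nil measure0.
rewrite !big_cons (le_trans (measureU2 _ _ _))//.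
  exact: bigsetU_measurable.
by rewrite leeD2l.
Qed.

Lemma measurable_lt_set d (T : measurableType d) (R : realType) (f : T -> R) (y : R) :
  measurable_fun setT f -> measurable [set w | f w < y].
Proof.
move=> mf; have := mf measurableT _ (measurable_itv `]-oo, y[); rewrite setTI.
by congr measurable; apply/seteqP; split=> w /=; rewrite in_itv.
Qed.

Lemma measurable_ge_set d (T : measurableType d) (R : realType) (f : T -> R) (y : R) :
  measurable_fun setT f -> measurable [set w | y <= f w].
Proof.
move=> mf; have := mf measurableT _ (measurable_itv `[y, +oo[); rewrite setTI.
by congr measurable; apply/seteqP; split=> w /=; rewrite in_itv /= andbT.
Qed.

(** * Exponential lower tails of Poisson counts and i.i.d. sums *)

Section lower_tails.
Context d (T : measurableType d) (R : realType) (P : probability T R).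

(** From (t/2)^k/k! <= e^(t/2), each Poisson weight is at most 2^k e^(-t/2). The geometric sum over
    k < K is below 2^K <= e^K. *)
Lemma Poisson_lower_tail (N : counting_process R T) (t : R) (K : nat) :
  is_Poisson_process P 1 N -> 0 < t ->
  (P [set w | (N t w < K)%N] <= (expR (K%:R - t / 2))%:E)%E.
Proof.
move=> hN t0.
have mN k : measurable [set w | N t w = k].
  have := Poisson_measurable hN (ltW t0) measurableT (_ : measurable [set k]).
  by rewrite setTI; exact.
have PN k : P [set w | N t w = k] = (poisson_pmf t k)%:E.
  have := Poisson_increments hN k (lexx 0) t0.
  rewrite subr0 mul1r => <-; congr (P _).
  by apply/seteqP; split=> w /=; rewrite (count_at0 N) subn0.
have -> : [set w | (N t w < K)%N] = \big[setU/set0]_(k < K) [set w | N t w = k].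
  rewrite -(bigcup_mkord K (fun k => [set w | N t w = k])); apply/seteqP.
  split=> w /=; first by move=> h; exists (N t w).
  by move=> [k /= kK ->].
apply: le_trans (@Boole_inequality _ _ _ P (fun k => [set w | N t w = k]) K _) _ => //.
rewrite (eq_bigr (fun k : 'I_K => (poisson_pmf t k)%:E)); last by move=> k _; exact: PN.
rewrite sumEFin lee_fin.
have pmf_le k : poisson_pmf t k <= 2 ^+ k * expR (- (t / 2)).
  have -> : - (t / 2) = t / 2 - t by lra.
  rewrite /poisson_pmf t0 expRD mulrA ler_wpM2r ?expR_ge0//.
  have th : 0 <= t / 2 by lra.
  have := ler_wpM2l (exprn_ge0 k (ler0n R 2)) (exprn_fact_le_expR k th).
  by rewrite mulrA -exprMn mulrCA divff// mulr1.
apply: le_trans (ler_sum _ (fun (i : 'I_K) _ => pmf_le i)) _.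
rewrite -mulr_suml expRD ler_wpM2r ?expR_ge0//.
have -> : \sum_(i < K) 2 ^+ i = 2 ^+ K - 1 :> R.
  elim: K => [|K ih]; first by rewrite big_ord0 expr0 subrr.
  by rewrite big_ord_recr /= ih exprS; lra.
apply: (@le_trans _ _ (2 ^+ K)); first by lra.
rewrite -[K%:R]mulr1 expRM_natl.
by rewrite lerXn2r ?nnegrE ?expR_ge0// two_le_expR1.
Qed.

(* Chernoff's bound for the number of i < K with c <= Z i, by summing over all
   patterns b : {ffun 'I_K -> bool} of the events c <= Z i. *)
Lemma iid_sum_lower_tail (Z : nat -> {RV P >-> R}) (c y : R) (K : nat) :
  (forall i w, 0 <= Z i w) ->
  mutually_independent P (fun i => Z i : T -> R) ->
  (forall i (B : set R), measurable B ->
     P (Z i @^-1` B) = P (Z 0%N @^-1` B)) ->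
  1 <= c ->
  (P [set w | (\sum_(i < K) Z i w < y)%R] <=
   (expR (y - fine (P [set w | (c <= Z 0%N w)%R]) * (1 - expR (- 1)) * K%:R))%:E)%E.
Proof.
move=> Z0 Zindep Zid c1.
pose D (b : bool) : set R := if b then [set x | c <= x] else [set x | x < c].
have mD b : measurable (D b).
  case: b; rewrite /D.
    by rewrite -[X in measurable X]set_itvcy; exact: measurable_itv.
  by rewrite -[X in measurable X]set_itvNyo; exact: measurable_itv.
pose p b := fine (P (Z 0%N @^-1` D b)).
have p0 b : 0 <= p b by rewrite fine_ge0.
have mZ i B : measurable B -> measurable (Z i @^-1` B).
  by move=> mB; rewrite -[_ @^-1` _]setTI; exact: measurable_funPT.
have pE b i : P (Z i @^-1` D b) = (p b)%:E.
  by rewrite Zid// fineK// fin_num_measure//; exact: mZ.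
have DU : D false `|` D true = setT.
  by apply/seteqP; split=> // x _ /=; case: (ltP x c) => h; [left|right].
have DI : D false `&` D true = set0.
  by apply/seteqP; split=> // x [] /=; case: ltgtP.
have psum : p false + p true = 1.
  apply: EFin_inj; rewrite EFinD -!(pE _ 0%N) -measureU; [|exact: mZ|exact: mZ|].
    by rewrite -preimage_setU DU preimage_setT; exact: probability_setT.
  by rewrite -preimage_setI DI preimage_set0.
(* Independence is stated for families indexed by all of [nat], so the pattern is padded with [setT]
   beyond [K]. *)
pose B (b : {ffun 'I_K -> bool}) (i : nat) : set R :=
  if insub i is Some j then D (b j) else setT.
have mB b i : measurable (B b i) by rewrite /B; case: insubP.
pose G b := \bigcap_(i in [set` iota 0 K]) (Z i @^-1` B b i).
have PG b : P (G b) = (\prod_(i < K) p (b i))%:E.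
  rewrite /G Zindep ?iota_uniq//.
  have -> : iota 0 K = index_iota 0 K by rewrite /index_iota subn0.
  rewrite big_mkord -prodEFin; apply: eq_bigr => i _.
  by rewrite -(pE _ i) /B valK.
have mG b : measurable (G b).
  by apply: fin_bigcap_measurable => // i _; exact: mZ.
(* The number of i with [c <= Z i]. Since [1 <= c] and [Z] is nonnegative, it is a lower bound for
   the sum, so only patterns with [wt b < y] can occur. *)
pose wt (b : {ffun 'I_K -> bool}) : R := \sum_(i < K) (b i)%:R.
pose s := [seq b <- enum {ffun 'I_K -> bool} | wt b < y].
have sub : [set w | \sum_(i < K) Z i w < y] `<=` \big[setU/set0]_(b <- s) G b.
  move=> w /= wy; rewrite -bigcup_seq.
  exists [ffun i : 'I_K => c <= Z i w].
    rewrite /= mem_filter mem_enum andbT (le_lt_trans _ wy)//.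
    apply: ler_sum => i _; rewrite ffunE; have [h|_] /= := leP c (Z i w); last exact: Z0.
    exact: le_trans c1 h.
  move=> i /=; rewrite /B; case: insubP => // j _ <- _.
  by rewrite /D ffunE /preimage /=; have [|] := leP c (Z j w).
have mS : measurable [set w | \sum_(i < K) Z i w < y].
  by apply: measurable_lt_set; apply: measurable_sum.
apply: (@le_trans _ _ (P (\big[setU/set0]_(b <- s) G b))).
  by apply: le_measure => //; rewrite inE//; exact: bigsetU_measurable.
apply: le_trans (measure_bigsetU_le _ _ mG) _.
rewrite (eq_bigr _ (fun b _ => PG b)).
rewrite sumEFin lee_fin.
(* Exponential Markov step: the restriction [wt b < y] is replaced by the factor [expR (y - wt b)],
   which splits over the coordinates. *)
apply: (@le_trans _ _ (\sum_(b : {ffun 'I_K -> bool})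
    expR y * \prod_(i < K) (p (b i) * expR (- (b i)%:R)))).
  rewrite big_filter big_enum_cond /= big_mkcond /=.
  apply: ler_sum => b _; rewrite big_split /= -expR_sum sumrN mulrCA -expRD.
  have pb0 : 0 <= \prod_(i < K) p (b i) by apply: prodr_ge0.
  case: ifPn => hb; last by rewrite mulr_ge0// expR_ge0.
  have ey : 1 <= expR (y - wt b).
    by rewrite (le_trans _ (expR_ge1Dx _))// lerDl subr_ge0 ltW.
  exact: ler_peMr.
(* The sum over all patterns factors as the K-th power of p(false) + p(true)/e = 1 - p(true)(1 -
   1/e), and 1 - x <= e^(-x). *)
rewrite -mulr_sumr -(bigA_distr_bigA (fun _ b => p b * expR (- b%:R))).
rewrite big_bool /= oppr0 expR0 mulr1 prodr_const card_ord expRD.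
rewrite ler_wpM2l ?expR_ge0// -mulNr [in leRHS]mulrC expRM_natl.
rewrite lerXn2r ?nnegrE ?expR_ge0//; first by rewrite addr_ge0// mulr_ge0.
apply: le_trans (expR_ge1Dx _).
rewrite -/(p true); move: psum; nra.
Qed.
End lower_tails.

(** * Path events expressed through the claim totals *)

Section sample_paths.
Context d (T : measurableType d) (R : realType) (P : probability T R).
Variables (N : counting_process R T) (Z : nat -> {RV P >-> R}).
Hypothesis mN : forall t : R, 0 <= t -> measurable_fun setT (N t).
Hypothesis Z0 : forall i w, 0 <= Z i w.

Definition claims (u : R) (w : T) : R := \sum_(i < N u w) Z i w.

Lemma measurable_claims u : 0 <= u -> measurable_fun setT (claims u).
Proof.
move=> u0 _ B mB; rewrite setTI.
have -> : claims u @^-1` B =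
    \bigcup_k ([set w | N u w = k] `&` (fun w => \sum_(i < k) Z i w) @^-1` B).
  apply/seteqP; split=> w /=; first by move=> Bw; exists (N u w).
  by move=> [k _ [<-]].
apply: bigcupT_measurable => k; apply: measurableI.
  have := mN u0 measurableT (_ : measurable [set k]).
  by rewrite setTI; exact.
by rewrite -[X in measurable X]setTI; apply: measurable_sum.
Qed.

Lemma claims_nondecreasing w u v : 0 <= u -> u <= v -> claims u w <= claims v w.
Proof.
move=> u0 uv; have := count_nondecreasing N w u0 uv.
rewrite /claims => /subnK <-; rewrite addnC big_split_ord /= lerDl.
exact: sumr_ge0.
Qed.

(** Lets a time be replaced by a slightly later one, in particular by a rational one, without
    changing the claim total. *)
Lemma claims_right_constant w u : 0 <= u ->
  exists2 e : R, 0 < e & forall v, u <= v -> v < u + e -> claims v w = claims u w.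
Proof.
move=> u0; have /nbhs_ballP[e /= e0 he] := count_right_continuous N w u0.
exists e => // v; rewrite le_eqVlt => /predU1P[<-//|uv] vue.
rewrite /claims he//= /ball /= distrC gtr0_norm ?subr_gt0//; lra.
Qed.

Lemma XbarD n w t : Xbar N Z n w t + \val t = n%:R^-1 * claims (n%:R * \val t) w.
Proof. by rewrite /= /Xbar_fun subrK. Qed.

(** Monotonicity carries the bound back from [s] to [a]; right constancy carries it from [a] to a
    later time, for which [a < 1] leaves room. *)
Lemma Xbar_low_after n (a eta : R) : (0 < n)%N -> 0 < a < 1 ->
  Xbar N Z n @^-1` low_after a eta = [set w | claims (n%:R * a) w < n%:R * eta].
Proof.
move=> n0 /andP[a0 a1].
have n0' : 0 < n%:R :> R by rewrite ltr0n.
apply/seteqP; split=> w /=.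
  move=> [s sa]; rewrite XbarD ltr_pdivrMl//; apply: le_lt_trans.
  by apply: claims_nondecreasing; [rewrite mulr_ge0// ltW|rewrite ler_pM2l// ltW].
move=> cl.
have na0 : 0 <= n%:R * a by rewrite mulr_ge0// ltW.
have [e e0 he] := claims_right_constant w na0.
pose v := Num.min 1 (a + e / 2 / n%:R).
have en : 0 < e / 2 / n%:R by rewrite !divr_gt0.
have av : a < v by rewrite lt_min a1/=; lra.
have v1 : v <= 1 by rewrite ge_min lexx.
have ve : v <= a + e / 2 / n%:R by rewrite ge_min lexx orbT.
have [s sv] : exists t : I01 R, \val t = v by apply: I01_ex; apply/andP; split; lra.
exists s; first by rewrite sv.
rewrite XbarD sv ltr_pdivrMl// he//; first by rewrite ler_pM2l// ltW.
have : n%:R * v <= n%:R * (a + e / 2 / n%:R) by rewrite ler_pM2l.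
rewrite mulrDr [n%:R * (_ / _)]mulrC divfK ?gt_eqF//; lra.
Qed.

Lemma Xbar_late_or_large n w : (0 < n)%N ->
  late_or_large (Xbar N Z n w) <->
  forall t : I01 R, ~ (0 < claims (n%:R * \val t) w < n%:R).
Proof.
move=> n0; have n0' : 0 < n%:R :> R by rewrite ltr0n.
split=> [[_ h] t /andP[c0 cn]|h].
  have := h t; rewrite XbarD => -[].
    by rewrite pmulr_rle0 ?invr_gt0// leNgt c0.
  by rewrite ler_pdivlMl// mulr1 leNgt cn.
split=> t.
  move=> t0; have := XbarD n w t; rewrite t0 addr0 mulr0 /claims (count_at0 N).
  by rewrite big_ord0 mulr0 => ->.
rewrite XbarD.
have [c0|c0] := leP (claims (n%:R * \val t) w) 0.
  by left; rewrite pmulr_rle0// invr_gt0.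
right; rewrite ler_pdivlMl// mulr1 leNgt; apply/negP => cn.
by apply: (h t); rewrite c0 cn.
Qed.

(** The complement is a countable union over rational times: a bad time below 1 has a rational to
    its right with the same claim total, and 1 is itself rational. *)
Lemma measurable_Xbar_late_or_large n : (0 < n)%N ->
  measurable (Xbar N Z n @^-1` late_or_large).
Proof.
move=> n0; have n0' : 0 < n%:R :> R by rewrite ltr0n.
pose F (q : rat) : set T := if 0 <= (ratr q : R) <= 1 then
  claims (n%:R * ratr q) @^-1` `]0, n%:R[ else set0.
have -> : Xbar N Z n @^-1` late_or_large = ~` \bigcup_q F q.
  rewrite setC_bigcup; apply/seteqP; split=> w.
    move=> /(Xbar_late_or_large w n0) h q _.
    rewrite /F; case: ifPn => [/I01_ex[t tq]|_] //=.
    by have := h t; rewrite tq /= in_itv.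
  move=> h; apply/(Xbar_late_or_large w n0) => t tbad.
  have /andP[t0 t1] := I01_bounds t.
  suff [q tq] : exists2 q : rat, 0 <= (ratr q : R) <= 1 &
      claims (n%:R * ratr q) w = claims (n%:R * \val t) w.
    by move=> qt; apply: (h q) => //; rewrite /F tq /= in_itv /= qt.
  move: t1; rewrite le_eqVlt => /predU1P[t1|t1].
    by exists 1; rewrite rmorph1 ?ler01 ?lexx// t1.
  have nt0 : 0 <= n%:R * \val t by rewrite mulr_ge0.
  have [e e0 he] := claims_right_constant w nt0.
  pose v := Num.min 1 (\val t + e / n%:R).
  have en : 0 < e / n%:R by rewrite divr_gt0.
  have tv : \val t < v by rewrite lt_min t1/=; lra.
  have [q] := rat_in_itvoo tv; rewrite in_itv /= lt_min => /and3P[tq q1 qe].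
  exists q; first by rewrite (ltW q1) (le_trans t0 (ltW tq)).
  apply: he; first by rewrite ler_pM2l// ltW.
  have : n%:R * ratr q < n%:R * (\val t + e / n%:R) by rewrite ltr_pM2l.
  by rewrite mulrDr [n%:R * (e / _)]mulrC divfK ?gt_eqF.
apply: measurableC; apply: countable_bigcupT_measurable => [|q]; first exact: countableP.
rewrite /F; case: ifPn => // /andP[q0 _]; rewrite -[X in measurable X]setTI.
exact: measurable_claims (mulr_ge0 (ler0n R n) q0) measurableT _ (measurable_itv _).
Qed.

(** The claim total is 0 before the first claim and at least [Z 0] from then on, so it skips
    (0,n). *)
Lemma first_claim_late_or_large n : (0 < n)%N ->
  [set w | n%:R <= Z 0%N w] `<=` Xbar N Z n @^-1` late_or_large.
Proof.
move=> n0 w /= Zn; apply/(Xbar_late_or_large w n0) => t.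
rewrite /claims; case: (N _ w) => [|k]; first by rewrite big_ord0 ltxx.
rewrite big_ord_recl /= => /andP[_]; rewrite ltNge => /negP; apply.
by rewrite (le_trans Zn)// lerDl sumr_ge0.
Qed.

End sample_paths.

(** * Probability estimates at speed n^(1/2) *)

Lemma powR_half_natr (R : realType) n : (0 < n)%N ->
  let r := n%:R `^ (1 / 2) : R in 1 <= r /\ r * r = n%:R.
Proof.
move=> n0; rewrite /= div1r powR12_sqrt// -expr2 sqr_sqrtr//.
by rewrite -{1}sqrtr1 ler_sqrt ?ltr0n// ler1n.
Qed.

Lemma limn_esup_ge (R : realType) (u : nat -> \bar R) (x : \bar R) :
  (\forall n \near \oo, x <= u n)%E -> (x <= limn_esup u)%E.
Proof.
move=> [M _ hM]; rewrite limn_esup_lim; apply: lime_ge; first exact: is_cvg_esups.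
apply: nearW => n; apply: (@le_trans _ _ (u (maxn n M))).
  by apply: hM; rewrite /= leq_maxr.
by apply: ereal_sup_ubound; exists (maxn n M) => //=; rewrite leq_maxl.
Qed.

Section tail_estimates.
Context d (T : measurableType d) (R : realType) (P : probability T R).
Variables (N : counting_process R T) (Z : nat -> {RV P >-> R}).
Hypothesis hN : is_Poisson_process P 1 N.
Hypothesis Z0 : forall i w, 0 <= Z i w.
Hypothesis Zindep : mutually_independent P (fun i => Z i : T -> R).
Hypothesis Zid : forall i (B : set R), measurable B ->
  P (Z i @^-1` B) = P (Z 0%N @^-1` B).
Hypothesis Ztail : fine (P [set w | x <= Z 0%N w]) / expR (- (x `^ (1 / 2)))
  @[x --> +oo] --> (1 : R).

(** The tail ratio tends to 1, hence eventually exceeds 1/e. The bound [1 <= c] makes [c] usable as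
    the threshold in [iid_sum_lower_tail]. *)
Lemma Ztail_ge : exists2 c : R, 1 <= c & forall x, c <= x ->
  ((expR (- 1 - x `^ (1 / 2)))%:E <= P [set w | (x <= Z 0%N w)%R])%E.
Proof.
have lt1 : expR (- 1) < 1 :> R by rewrite -[ltRHS]expR0 ltr_expR; lra.
have [M [_ hM]] := cvgr_gt _ Ztail _ lt1.
exists (Num.max 1 (M + 1)); first by rewrite le_max lexx.
move=> x; rewrite ge_max => /andP[x1 Mx].
have mZx : measurable [set w | x <= Z 0%N w] by exact: measurable_ge_set.
rewrite -(@fineK _ (P _)) ?fin_num_measure// lee_fin.
have /hM : M < x by lra.
by rewrite /= ltr_pdivlMr ?expR_gt0// -expRD => /ltW.
Qed.

(** With r = n^(1/2) >= 1, the first claim alone gives the exponent (-1 - r)/r >= -2. *)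
Lemma Xbar_late_or_large_ge : \forall n \near \oo,
  ((- 2)%:E <= ((n%:R `^ (1 / 2))^-1)%:E *
    lne (P (Xbar N Z n @^-1` late_or_large)))%E.
Proof.
have [c c1 hc] := Ztail_ge.
near=> n.
have cn : c <= n%:R by near: n; exact: nbhs_infty_ger.
have n0 : (0 < n)%N by rewrite -(ltr0n R) (lt_le_trans _ cn)// (lt_le_trans _ c1).
have [r1 _] := powR_half_natr R n0.
set r := n%:R `^ (1 / 2) in r1 *.
have mA := measurable_Xbar_late_or_large Z (Poisson_measurable hN) n0.
have le_P : ((expR (- 1 - r))%:E <= P (Xbar N Z n @^-1` late_or_large))%E.
  apply: le_trans (hc _ cn) _.
  apply: le_measure; [rewrite inE|rewrite inE//|exact: first_claim_late_or_large].
  exact: measurable_ge_set.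
apply: (@le_trans _ _ (r^-1%:E * (- 1 - r)%:E)%E).
  rewrite -EFinM lee_fin ler_pdivlMl; lra.
apply: lee_wpmul2l; first by rewrite lee_fin invr_ge0; lra.
rewrite -[X in (X <= _)%E]expeRK lee_lne ?in_itv/= ?leey ?lee_fin ?expR_ge0//.
by rewrite (le_trans _ le_P) ?lee_fin ?expR_ge0.
Unshelve. all: by end_near.
Qed.

(** Union bound: a low claim total at time na means either fewer than K arrivals or a small sum of
    the first K claims. *)
Lemma low_after_decay (a : R) : 0 < a < 1 ->
  exists eta b : R, [/\ 0 < eta, 0 < b & forall n, (0 < n)%N ->
    (P (Xbar N Z n @^-1` low_after a eta) <= (expR (2 - b * n%:R))%:E)%E].
Proof.
move=> a01; have /andP[a0 a1] := a01.
have [c c1 hc] := Ztail_ge.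
pose q := fine (P [set w | c <= Z 0%N w]).
have mZc : measurable [set w | c <= Z 0%N w] by exact: measurable_ge_set.
have q0 : 0 < q.
  rewrite -lte_fin fineK ?fin_num_measure//.
  by apply: lt_le_trans (hc c (lexx c)); rewrite lte_fin expR_gt0.
have q1 : q <= 1.
  by rewrite -lee_fin fineK ?fin_num_measure//; exact: probability_le1.
have e1 : expR (- 1) < 1 :> R by rewrite -[ltRHS]expR0 ltr_expR; lra.
pose k := q * (1 - expR (- 1)).
have k0 : 0 < k by rewrite mulr_gt0// subr_gt0.
have k1 : k <= 1 by have := expR_gt0 (- 1 : R); rewrite /k; nra.
(* With K about na/4, the mean count na exceeds K by far, and the level [y] = nka/8 is half of the
   Chernoff exponent kK, about nka/4. Rounding K costs at most k <= 1, absorbed by the 1 in [E]. *)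
exists (k * a / 8), (k * a / 8).
have ka0 : 0 < k * a by rewrite mulr_gt0.
split; [lra|lra|move=> n n0].
rewrite (Xbar_low_after N Z0 _ n0 a01).
have n0' : 0 < n%:R :> R by rewrite ltr0n.
set y := n%:R * (k * a / 8).
pose K := Num.trunc (n%:R * a / 4).
have na0 : 0 < n%:R * a by rewrite mulr_gt0.
have /andP[K1 K2] : K%:R <= n%:R * a / 4 < K%:R + 1.
  by rewrite natr1; apply: truncn_itv; lra.
have PN := Poisson_lower_tail K hN na0.
have PZ := iid_sum_lower_tail y K Z0 Zindep Zid c1.
have mNK : measurable [set w | (N (n%:R * a)%R w < K)%N].
  have := Poisson_measurable hN (ltW na0) measurableT (_ : measurable `I_K).
  by rewrite setTI; exact.
have mZy : measurable [set w | \sum_(i < K) Z i w < y].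
  by apply: measurable_lt_set; apply: measurable_sum.
have mcl := measurable_claims Z (Poisson_measurable hN) (ltW na0).
apply: (@le_trans _ _ (P ([set w | (N (n%:R * a)%R w < K)%N] `|`
    [set w | (\sum_(i < K) Z i w < y)%R]))).
  apply: le_measure; rewrite ?inE.
  - exact: measurable_lt_set.
  - exact: measurableU.
  - move=> w /= cl; have [|KN] := ltnP (N (n%:R * a) w) K; first by left.
    right; apply: le_lt_trans cl; rewrite /claims -(subnK KN) addnC big_split_ord.
    by rewrite lerDl; apply: sumr_ge0.
apply: le_trans (measureU2 _ mNK mZy) _.
apply: le_trans (leeD PN PZ) _.
rewrite -EFinD lee_fin -/q -/k.
set E := expR (1 - k * a / 8 * n%:R).
have P1 : expR (K%:R - n%:R * a / 2) <= E.
  rewrite ler_expR; nra.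
have P2 : expR (y - k * K%:R) <= E.
  rewrite ler_expR /y; nra.
have -> : 2 - k * a / 8 * n%:R = 1 + (1 - k * a / 8 * n%:R) by lra.
rewrite [leRHS]expRD -/E; apply: (le_trans (lerD P1 P2)).
rewrite -mulr2n -[E *+ 2]mulr_natl ler_wpM2r ?expR_ge0//; exact: two_le_expR1.
Qed.

Lemma low_after_cvgNy (a eta b : R) : 0 < b ->
  (forall n, (0 < n)%N ->
    (P (Xbar N Z n @^-1` low_after a eta) <= (expR (2 - b * n%:R))%:E)%E) ->
  (((n%:R `^ (1 / 2))^-1)%:E * lne (P (Xbar N Z n @^-1` low_after a eta)))%E
    @[n --> \oo] --> -oo%E.
Proof.
move=> b0 hb; apply/cvgeNyPle => A.
(* Once r = n^(1/2) >= L, b r >= 2 - A, and with r >= 1 this gives 2 - b r^2 <= A r. *)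
pose L := `|2 - A| / b.
have L0 : 0 <= L by rewrite divr_ge0// ltW.
near=> n.
have n0 : (0 < n)%N by near: n; exact: nbhs_infty_gt.
have Ln : L ^+ 2 <= n%:R by near: n; exact: nbhs_infty_ger.
have [r1 rr] := powR_half_natr R n0.
set r := n%:R `^ (1 / 2) in r1 rr *.
have Lr : L <= r by rewrite -rr -expr2 ler_sqr ?nnegrE// in Ln; lra.
apply: (@le_trans _ _ (r^-1%:E * (2 - b * n%:R)%:E)%E).
  apply: lee_wpmul2l; first by rewrite lee_fin invr_ge0; lra.
  rewrite -[X in (_ <= X)%E]expeRK lee_lne ?in_itv/= ?leey ?andbT ?measure_ge0 ?lee_fin
    ?expR_ge0//.
  exact: hb.
rewrite -EFinM lee_fin ler_pdivrMl; last lra.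
have : `|2 - A| <= b * r by rewrite mulrC -ler_pdivrMr.
move=> /(le_trans (ler_norm _)) h.
rewrite -rr; nra.
Unshelve. all: by end_near.
Qed.

End tail_estimates.

(** * Failure of the upper bound and of every full LDP *)

Lemma closed_sigma_open (S : topologicalType) (A : set S) :
  closed A -> <<s [set U : set S | open U] >> A.
Proof.
move=> cA M [[M0 MC MU] GM]; rewrite -(setCK A) -setTD; apply: MC; apply: GM.
exact: closed_openC.
Qed.

Theorem mainTheorem5 (d : measure_display) (T : measurableType d)
    (R : realType) (P : probability T R) (alpha : R)
    (N : counting_process R T) (Z : nat -> {RV P >-> R})
    (halpha : alpha = 1 / 2)
    (hN : is_Poisson_process P 1 N)
    (hZ0 : forall i w, 0 <= Z i w)
    (hZindep : mutually_independent P (fun i => Z i : T -> R))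
    (hZid : forall i (B : set R), measurable B ->
       P (Z i @^-1` B) = P (Z 0%N @^-1` B))
    (hZN : independent_classes P
       (sigma_gen [set: nat] (fun i => Z i : T -> R))
       (sigma_gen [set t : R | 0 <= t] N))
    (hEZ : ('E_P[Z 0%N] = 1)%E)
    (htail : fine (P [set w | x <= Z 0%N w]) / expR (- (x `^ alpha))
       @[x --> +oo] --> (1 : R)) :
  (exists A : set (skorokhod R), closed A /\
     (- ereal_inf (rate_function alpha @` A) <
      limn_esup (fun n : nat =>
        ((n%:R `^ alpha)^-1)%:E * lne (P (Xbar N Z n @^-1` A))))%E) /\
  ~ (exists J : skorokhod R -> \bar R,
       full_LDP P (Xbar N Z) (fun n : nat => n%:R `^ alpha) J).
Proof.
subst alpha.
have limA := limn_esup_ge (Xbar_late_or_large_ge hN hZ0 htail).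
split.
  exists late_or_large; split; first exact: closed_late_or_large.
  by rewrite rate_late_or_large (lt_le_trans _ limA)// ltNyr.
move=> [J [_ _ bounds]].
(* The upper bound on the closed set gives inf J <= 2 there, so some [xi] in it has J below 3. *)
have [_ _] := bounds _ (closed_sigma_open (@closed_late_or_large R)).
rewrite -(closure_id _).1; last exact: closed_late_or_large.
move=> /(le_trans limA); rewrite leeNr => infJ.
have /ereal_inf_lt[_ [xi xiA <-] Jxi] :
    (ereal_inf (J @` late_or_large) < 3%:E)%E.
  by rewrite (le_lt_trans infJ)// -EFinN lte_fin; lra.
have [s /andP[s0 s1] xis] := late_or_large_start xiA.
have a01 : 0 < \val s / 2 < 1 by apply/andP; split; lra.
have [eta [b [eta0 b0 hb]]] := low_after_decay hN hZ0 hZindep hZid htail a01.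
pose U : set (skorokhod R) := low_after (\val s / 2) eta.
have bU : <<s [set V : set (skorokhod R) | open V] >> U.
  by apply: sub_sigma_algebra; exact: open_low_after.
(* The lower bound on the open set [U] forces J = +oo throughout [U], which contains [xi] because
   [xi s + \val s <= 0 < eta]. *)
have [+ _ _] := bounds _ bU.
rewrite (cvgNy_limn_einf_sup (low_after_cvgNy b0 hb)).1 leeNl leye_eq => /eqP infJoo.
have : (ereal_inf (J @` U°) <= J xi)%E.
  apply: ereal_inf_lbound; exists xi => //.
  rewrite ((interior_id U).1 (@open_low_after _ _ _)).
  by exists s; lra.
by rewrite infJoo => /le_lt_trans /(_ Jxi).
Qed.
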